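(* Let $\mathbf{G}=\mathbf{N}\bowtie\mathbf{H}$ be a finite group which is the internal knit product of its subgroups $\mathbf{N}$ and $\mathbf{H}$, with $\mathbf{N}$ Abelian, and put $\mathfrak{g}=|\mathbf{G}|$, $\mathfrak{n}=|\mathbf{N}|$, $\mathfrak{h}=|\mathbf{H}|$. Let $g\mapsto U(g)$ be a unitary representation of $\mathbf{G}$ on a complex Hilbert space $\mathcal{H}$, let $\mathsf{a}\in\mathcal{H}$ be such that the family $\{U(g)\mathsf{a}\}_{g\in\mathbf{G}}$ is linearly independent, let $\mathcal{A}_{\mathsf{a}}=\operatorname{span}\{U(g)\mathsf{a}\}_{g\in\mathbf{G}}$, and let $\mathsf{b}_1,\dots,\mathsf{b}_\kappa\in\mathcal{H}$ (not necessarily in $\mathcal{A}_{\mathsf{a}}$). Let $\mathcal{L}_k\mathsf{f}(\nu_n)$ be the generalized samples and $\mathbb{R}_{\mathsf{a},\mathbf{b}}$ the $\mathfrak{n}\kappa\times\mathfrak{g}$ cross-covariance matrix defined in the context. The following statements are equivalent: 1. $\operatorname{rank}\mathbb{R}_{\mathsf{a},\mathbf{b}}=\mathfrak{g}$. 2. There exists an $\mathfrak{h}\times\mathfrak{n}\kappa$ complex matrix $\mathbb{S}$ such that $\mathbb{S}\,\mathbb{R}_{\mathsf{a},\mathbf{b}}=\big(\mathbb{I}_{\mathfrak{h}}\ \ \mathbb{O}_{\mathfrak{h}\times(\mathfrak{g}-\mathfrak{h})}\big)$. 3. There exist vectors $\mathsf{c}_k\in\mathcal{A}_{\mathsf{a}}$,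 $k=1,\dots,\kappa$, such that $\{U(\nu_n)\mathsf{c}_k\}_{k=1,\dots,\kappa;\,n=1,\dots,\mathfrak{n}}$ is a frame (spanning set) for $\mathcal{A}_{\mathsf{a}}$, and for any $\mathsf{f}\in\mathcal{A}_{\mathsf{a}}$ we have $$\mathsf{f}=\sum_{k=1}^{\kappa}\sum_{n=1}^{\mathfrak{n}}\mathcal{L}_k\mathsf{f}(\nu_n)\,U(\nu_n)\mathsf{c}_k .$$ 4. There exists a frame $\{\mathsf{C}_{k,n}\}_{k=1,\dots,\kappa;\,n=1,\dots,\mathfrak{n}}$ for $\mathcal{A}_{\mathsf{a}}$ such that, for each $\mathsf{f}\in\mathcal{A}_{\mathsf{a}}$, $$\mathsf{f}=\sum_{k=1}^{\kappa}\sum_{n=1}^{\mathfrak{n}}\mathcal{L}_k\mathsf{f}(\nu_n)\,\mathsf{C}_{k,n}.$$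
   Context: $\mathbf{G}$ is the internal knit (Zappa–Szép) product $\mathbf{N}\bowtie\mathbf{H}$ of subgroups $\mathbf{N},\mathbf{H}$ if $\mathbf{G}=\mathbf{N}\mathbf{H}$ and $\mathbf{N}\cap\mathbf{H}=\{1_{\mathbf{G}}\}$. Fix enumerations $\mathbf{N}=\{\nu_1=1_{\mathbf{G}},\nu_2,\dots,\nu_{\mathfrak{n}}\}$ and $\mathbf{H}=\{\tau_1=1_{\mathbf{G}},\tau_2,\dots,\tau_{\mathfrak{h}}\}$; then $\mathbf{G}=\bigcup_{j=1}^{\mathfrak{n}}\nu_j^{-1}\mathbf{H}$ (disjoint union), and $\mathbf{G}$ is listed in the order $\nu_1^{-1}\tau_1,\dots,\nu_1^{-1}\tau_{\mathfrak{h}},\nu_2^{-1}\tau_1,\dots,\nu_2^{-1}\tau_{\mathfrak{h}},\dots,\nu_{\mathfrak{n}}^{-1}\tau_{\mathfrak{h}}$. Inner products are linear in the first argument. Generalized samples: $\mathcal{L}_k\mathsf{f}(\nu_n):=\langle\mathsf{f},U(\nu_n)\mathsf{b}_k\rangle_{\mathcal{H}}$ for $\mathsf{f}\in\mathcal{A}_{\mathsf{a}}$, $n=1,\dots,\mathfrak{n}$, $k=1,\dots,\kappa$. Cross-covariance: $r_{\mathsf{a},\mathsf{b}}(g):=\langle U(g)\mathsf{a},\mathsf{b}\rangle_{\mathcal{H}}$, $g\in\mathbf{G}$. For each $k$, $\mathbb{R}_{\mathsf{a},\mathsf{b}_k}$ is the $\mathfrak{n}\times\mathfrak{g}$ matrix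 whose entry in row $n$ and in the column indexed by $\nu_j^{-1}\tau_i$ (the columns being indexed by $\mathbf{G}$ listed in the order $\nu_1^{-1}\tau_1,\dots,\nu_1^{-1}\tau_{\mathfrak{h}},\nu_2^{-1}\tau_1,\dots,\nu_2^{-1}\tau_{\mathfrak{h}},\dots,\nu_{\mathfrak{n}}^{-1}\tau_{\mathfrak{h}}$) is $r_{\mathsf{a},\mathsf{b}_k}(\nu_n^{-1}\nu_j^{-1}\tau_i)$. The cross-covariance matrix $\mathbb{R}_{\mathsf{a},\mathbf{b}}$ is the $\mathfrak{n}\kappa\times\mathfrak{g}$ matrix obtained by stacking $\mathbb{R}_{\mathsf{a},\mathsf{b}_1},\dots,\mathbb{R}_{\mathsf{a},\mathsf{b}_\kappa}$ vertically in this order. $\mathbb{I}_{m}$ is the identity matrix of order $m$ and $\mathbb{O}_{m\times p}$ the $m\times p$ zero matrix. A finite family $\{x_i\}$ in a finite-dimensional Hilbert space $V$ is a frame for $V$ if there are $0<A\le B$ with $A\|x\|^2\le\sum_i|\langle x,x_i\rangle|^2\le B\|x\|^2$ for all $x\in V$; equivalently, it spans $V$. *)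

(* Defs.v *)
From HB Require Import structures.
From mathcomp Require Export all_boot all_order all_algebra all_fingroup.
From mathcomp Require Export complex.
From mathcomp Require Export all_classical all_reals topology normedtype.

Set Implicit Arguments.
Unset Strict Implicit.
Unset Printing Implicit Defensive.

Export Order.TTheory GRing.Theory Num.Theory.
Export numFieldNormedType.Exports.

Local Open Scope classical_set_scope.
Local Open Scope complex_scope.
Local Open Scope ring_scope.

Definition knit_product (gT : finGroupType) (N H : {group gT}) : Prop :=
  (N * H)%g = [set: gT]%SET /\ (N :&: H)%g = 1%g.

(* The "forall i, i = 0" guard stands for the first index: 'I_#|A| is not
   syntactically of the form 'I_n.+1, so ord0 is not available. *)
Definition enumeration (gT : finGroupType) (A : {group gT})
    (e : 'I_#|A| -> gT) : Prop :=
  [/\ injective e, codom e =i A & forall i : 'I_#|A|, i = 0%N :> nat -> e i = 1%g].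

Section Hilbert.
Variables (R : realType) (V : completeNormedModType R[i]).
Variable dot : {dot V for Num.conj}.

(* [dot] is an inner product (linear on the left, conjugate-linear on the
   right); this makes the complete norm of V the one it induces. *)
Definition hilbert_norm : Prop := forall x : V, `|x| ^+ 2 = dot x x.

Definition unitary (T : V -> V) : Prop := bijective T /\ isometry dot dot T.

Definition unitary_representation (gT : finGroupType)
    (U : gT -> {linear V -> V}) : Prop :=
  (forall g, unitary (U g)) /\ (forall g h x, U (g * h)%g x = U g (U h x)).

Definition lin_indep (I : finType) (v : I -> V) : Prop :=
  forall c : I -> R[i], \sum_i c i *: v i = 0 -> forall i, c i = 0.

Definition lin_span (I : finType) (v : I -> V) : set V :=
  [set x | exists c : I -> R[i], x = \sum_i c i *: v i].

Definition frame_for (W : set V) (I : finType) (v : I -> V) : Prop :=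
  (forall i, W (v i)) /\
  exists A B : R, [/\ 0 < A, A <= B & forall x, W x ->
    A%:C * `|x| ^+ 2 <= \sum_i `|dot x (v i)| ^+ 2 <= B%:C * `|x| ^+ 2].

Section Sampling.
Variables (gT : finGroupType) (N H : {group gT}).
Variables (nu : 'I_#|N| -> gT) (tau : 'I_#|H| -> gT).
Variable U : gT -> {linear V -> V}.

(* The generalized sample of f at nu_n, for one vector b *)
Definition sample (b f : V) (n : 'I_#|N|) : R[i] := dot f (U (nu n) b).

Definition cross_cov (a b : V) (g : gT) : R[i] := dot (U g a) b.

(* The j-th block of columns is indexed by nu_j^-1 tau_1, nu_j^-1 tau_2, ... *)
Definition cross_cov_mx1 (a b : V) : 'M[R[i]]_(#|N|, \sum_(j < #|N|) #|H|) :=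
  \mxrow_(j < #|N|) \matrix_(n < #|N|, i < #|H|)
    cross_cov a b ((nu n)^-1 * (nu j)^-1 * tau i)%g.

(* \mxcol and \mxrow only produce dimensions of the form \sum_(_ < _) _; these
   are kappa * #|N| and #|gT|, see cross_cov_nrows and cross_cov_ncols. *)
Definition cross_cov_mx (kappa : nat) (a : V) (b : 'I_kappa -> V) :
    'M[R[i]]_(\sum_(k < kappa) #|N|, \sum_(j < #|N|) #|H|) :=
  \mxcol_(k < kappa) cross_cov_mx1 a (b k).

End Sampling.
End Hilbert.

Lemma cross_cov_nrows (gT : finGroupType) (N : {group gT}) (kappa : nat) :
  (\sum_(k < kappa) #|N| = kappa * #|N|)%N.
Proof. by rewrite sum_nat_const card_ord. Qed.

Lemma cross_cov_ncols (gT : finGroupType) (N H : {group gT}) :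
  knit_product N H -> (\sum_(j < #|N|) #|H| = #|gT|)%N.
Proof.
move=> [NH tiNH].
by rewrite sum_nat_const card_ord -(TI_cardMg tiNH) NH cardsT.
Qed.

(* Main.v *)
Require Import Defs.
From mathcomp Require Import ring.

(** Write [x = \sum_g f g *: U g a] for a vector of the orbit span. By unitarity
    the samples of [x] are the entries of the cross-covariance matrix times the
    column of coefficients of [x] ([cross_cov_mx_coef_col]), so everything is
    about reconstructing [f] from that product.

    If the matrix has full column rank it has a left inverse, whose first [#|H|]
    rows satisfy S R = (I O). Such an S recovers from the samples only the
    coefficients [f (tau i)], those in the first block of columns
    ([partial_left_inverse_coef]). The group action does the rest: the
    coefficient of [x] at [y * tau i], with [y] in [N], is the coefficient of
    [U y^-1 x] at [tau i], and the samples of [U y^-1 x] are again samples of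
    [x], since they are inner products of [x] with vectors [U z (b k)], [z] in
    [N]. Each element of the group is uniquely of the form [y * tau i], so all
    coefficients are recovered, and collecting the terms that contain the same
    sample yields the reconstruction formula with the [N]-orbits of the vectors
    [dual_generator k] ([dual_generator_reconstruction]).

    A reconstruction formula whose coefficients are inner products makes its
    vectors a frame, because the analysis map of the dual family is bounded
    ([frame_reconstruction]). Finally, a reconstruction formula makes the
    sampling map injective on the orbit span; as the orbit of [a] is linearly
    independent, the matrix then has trivial kernel, hence full column rank
    ([cross_cov_mx_full_rank]). *)

Set Implicit Arguments.
Unset Strict Implicit.
Unset Printing Implicit Defensive.

Local Open Scope classical_set_scope.
Local Open Scope complex_scope.
Local Open Scope ring_scope.

(** * Inner products and frames *)

Section InnerProduct.
Variables (R : realType) (V : completeNormedModType R[i]).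
Variable dot : {dot V for Num.conj}.

Lemma dot_conj u v : dot v u = (dot u v)^*%R.
Proof. by rewrite hermC expr0 mul1r. Qed.

Lemma normC_dotC u v : `|dot v u| = `|dot u v|.
Proof. by rewrite dot_conj norm_conjC. Qed.

(** Expand the squared norm of [dot v v *: u - dot u v *: v], which is [dot v v]
    times the component of [u] orthogonal to [v]. *)
Lemma dot_CauchySchwarz u v : `|dot u v| ^+ 2 <= dot u u * dot v v.
Proof.
have [->|v0] := eqVneq v 0; first by rewrite !linear0r normr0 expr0n mulr0.
have vv_gt0 : 0 < dot v v by rewrite dnorm_gt0.
rewrite -(ler_pM2r vv_gt0) -subr_ge0.
suff <- : dot (dot v v *: u - dot u v *: v) (dot v v *: u - dot u v *: v)
    = dot u u * dot v v * dot v v - `|dot u v| ^+ 2 * dot v v.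
  exact: dnorm_ge0.
have vvC : (dot v v)^*%R = dot v v by rewrite -dot_conj.
rewrite linearBl !linearBr !linearZl_LR !linearZr_LR /= vvC.
rewrite -(dot_conj u v) normCK -dot_conj.
by ring.
Qed.


Hypothesis dot_norm : hilbert_norm dot.

Lemma dot_CauchySchwarz_norm u v : `|dot u v| ^+ 2 <= `|u| ^+ 2 * `|v| ^+ 2.
Proof. by rewrite !dot_norm dot_CauchySchwarz. Qed.

(** By Cauchy-Schwarz, the sum of the [`|v i| ^+ 2] is a bound; adding 1 makes it
    serve as an upper frame bound and, inverted, as a lower one that cannot
    exceed such an upper bound. *)
Lemma bessel_bound (I : finType) (v : I -> V) :
  exists2 M : R, 1 <= M &
    forall x, \sum_i `|dot x (v i)| ^+ 2 <= M%:C * `|x| ^+ 2.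
Proof.
have S_ge0 : 0 <= \sum_i `|v i| ^+ 2 by apply: sumr_ge0 => i _; exact: exprn_ge0.
have SE := RRe_real (ger0_real S_ge0).
exists (1 + complex.Re (\sum_i `|v i| ^+ 2)).
  by rewrite lerDl -lecR SE.
move=> x; rewrite rmorphD/= SE.
rewrite mulrDl mulr_suml -[leLHS]add0r lerD//; first by rewrite mul1r exprn_ge0.
by apply: ler_sum => i _; rewrite [leRHS]mulrC dot_CauchySchwarz_norm.
Qed.

(** The difference of the two sides is [(x - m * y) ^+ 2 / (2 * m)]. *)
Lemma weighted_AMGM (K : numFieldType) (m x y : K) : 0 < m -> 0 <= x -> 0 <= y ->
  x * y <= (2 * m)^-1 * x ^+ 2 + m / 2 * y ^+ 2.
Proof.
move=> m0 x0 y0; rewrite -subr_ge0.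
have -> : (2 * m)^-1 * x ^+ 2 + m / 2 * y ^+ 2 - x * y
    = (2 * m)^-1 * (x - m * y) ^+ 2.
  by field; rewrite gt_eqF.
apply: mulr_ge0; first by rewrite invr_ge0 mulr_ge0 ?ltW.
by rewrite -realEsqr rpredB ?rpredM ?ger0_real// ltW.
Qed.

(** The lower frame bound comes from pairing the reconstruction formula with [x]:
    [`|x| ^+ 2 = \sum_i dot x (w i) * dot (v i) x]. When the weight in
    [weighted_AMGM] is a Bessel bound of the dual family [w], the right-hand side
    is at most half of [`|x| ^+ 2] plus a multiple of
    [\sum_i `|dot x (v i)| ^+ 2], and the half is absorbed on the left. *)
Lemma frame_reconstruction (W : set V) (I : finType) (v w : I -> V) :
  (forall i, W (v i)) ->
  (forall x, W x -> x = \sum_i dot x (w i) *: v i) ->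
  frame_for dot W v.
Proof.
move=> Wv rec; split=> //.
have [B B1 leB] := bessel_bound v; have [M M1 leM] := bessel_bound w.
have M0 : 0 < M by apply: lt_le_trans M1.
exists M^-1, B; split=> [||x Wx].
- by rewrite invr_gt0.
- by apply: le_trans B1; rewrite invf_le1.
rewrite leB andbT.
have MC0 : 0 < M%:C by rewrite ltcR.
suff : `|x| ^+ 2 <= 2^-1 * `|x| ^+ 2 + M%:C / 2 * \sum_i `|dot x (v i)| ^+ 2.
  move=> le_x; rewrite fmorphV -ler_pdivlMl ?invr_gt0// invrK -subr_ge0.
  rewrite -(pmulr_rge0 _ (_ : 0 < 2^-1)) ?invr_gt0//; move: le_x; rewrite -subr_ge0.
  by congr (0 <= _); field.
have sumE : `|x| ^+ 2 = \sum_i dot x (w i) * dot (v i) x.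
  rewrite dot_norm {1}(rec x Wx) linear_sumlz.
  by apply: eq_bigr => i _; rewrite linearZl_LR.
rewrite -{1}(ger0_norm (exprn_ge0 2 (normr_ge0 x))) {1}sumE.
apply: le_trans (ler_norm_sum _ _ _) _.
apply: (@le_trans _ _ (\sum_i ((2 * M%:C)^-1 * `|dot x (w i)| ^+ 2
    + M%:C / 2 * `|dot x (v i)| ^+ 2))).
  apply: ler_sum => i _; rewrite normrM (normC_dotC x).
  exact: weighted_AMGM.
rewrite big_split/= -!mulr_sumr lerD2r.
apply: (@le_trans _ _ ((2 * M%:C)^-1 * (M%:C * `|x| ^+ 2))).
  by rewrite ler_pM2l ?invr_gt0 ?mulr_gt0// leM.
by rewrite le_eqVlt; apply/orP; left; apply/eqP; field; rewrite gt_eqF.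
Qed.

End InnerProduct.
(** * Coordinates in a knit product *)

Section Knit.
Variables (gT : finGroupType) (N H : {group gT}).
Hypothesis knitNH : knit_product N H.
Variables (nu : 'I_#|N| -> gT) (tau : 'I_#|H| -> gT).
Hypotheses (nuP : enumeration nu) (tauP : enumeration tau).

Lemma enumeration_mem (A : {group gT}) (e : 'I_#|A| -> gT) :
  enumeration e -> forall i, e i \in A.
Proof. by move=> [_ eA _] i; rewrite -eA codom_f. Qed.

Lemma reindex_enumeration (T : nmodType) (A : {group gT})
    (e : 'I_#|A| -> gT) (F : gT -> T) :
  enumeration e -> \sum_(i < #|A|) F (e i) = \sum_(x in A) F x.
Proof.
move=> [e_inj eA _].
rewrite -(eq_bigl _ _ eA) -big_uniq ?map_inj_uniq ?enum_uniq//.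
by rewrite big_map big_enum.
by rewrite -enumT enum_uniq.
Qed.

Definition knit_elt (p : 'I_#|N| * 'I_#|H|) : gT := ((nu p.1)^-1 * tau p.2)%g.

Lemma knit_elt_bij : bijective knit_elt.
Proof.
have [NH tiNH] := knitNH; have [nu_inj _ _] := nuP; have [tau_inj _ _] := tauP.
apply: inj_card_bij; last first.
  by rewrite card_prod !card_ord -cardsT -NH (TI_cardMg tiNH).
move=> [j i] [j' i']; rewrite /knit_elt/= => eq_g.
have eq_q : (nu j' * (nu j)^-1 = tau i' * (tau i)^-1)%g.
  by apply: (canRL (mulgK _)); rewrite -mulgA eq_g mulKVg.
have : (nu j' * (nu j)^-1)%g \in N :&: H.
  by rewrite inE {2}eq_q !groupM ?groupV ?enumeration_mem.
rewrite tiNH => /set1gP q1; move: eq_q; rewrite q1 => /esym.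
move=> /(canRL (mulgKV _)); rewrite mul1g => /tau_inj ->.
by move: q1 => /(canRL (mulgKV _)); rewrite mul1g => /nu_inj ->.
Qed.

(** The left cosets of [H] are listed by the [(nu j)^-1], but the inverses
    disappear when one sums over all of [N]. *)
Lemma sum_knit (T : nmodType) (F : gT -> T) :
  \sum_g F g = \sum_(y in N) \sum_(i < #|H|) F (y * tau i)%g.
Proof.
rewrite (reindex knit_elt); last exact/onW_bij/knit_elt_bij.
rewrite -(pair_bigA _ (fun j i => F (knit_elt (j, i))))/=.
rewrite (reindex_enumeration (fun y => \sum_(i < #|H|) F (y^-1 * tau i)%g) nuP).
by rewrite (reindex_inj invg_inj)/=; apply: eq_big => y; rewrite ?groupV ?invgK.
Qed.

Section CoefCol.
Variable K : pzSemiRingType.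

Definition coef_col (f : gT -> K) : 'cV[K]_(\sum_(j < #|N|) #|H|) :=
  \mxcol_(j < #|N|) \col_(i < #|H|) f (knit_elt (j, i)).

Lemma coef_col0 f : (forall g, f g = 0) -> coef_col f = 0.
Proof.
move=> f0; rewrite /coef_col -mxcol0; apply: eq_mxcol => j.
by apply/colP => i; rewrite !mxE f0.
Qed.

Lemma coef_col_surj x : exists f, x = coef_col f.
Proof.
have [knit_inv knitK _] := knit_elt_bij.
exists (fun g => submxcol x (knit_inv g).1 (knit_inv g).2 0).
rewrite -[LHS]submxcolK; apply: eq_mxcol => j; apply/colP => i.
by rewrite [RHS]mxE knitK.
Qed.

(** [pid_mx #|H|] selects the first block, whose columns are indexed by
    [(nu j0)^-1 * tau i = tau i] because [nu j0 = 1] for the first index [j0]. *)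
Lemma pid_mx_coef_col f :
  pid_mx #|H| *m coef_col f = \col_(i < #|H|) f (tau i).
Proof.
pose j0 : 'I_#|N| := Ordinal (cardG_gt0 N).
have -> : pid_mx #|H| =
    \mxrow_(j < #|N|) (if j == j0 then 1%:M else 0) :> 'M[K]_(#|H|, _).
  apply/mxrowP => j; rewrite mxrowK; apply/matrixP => i i'.
  rewrite !mxE ltn_ord andbT.
  have {1}-> : i = tagnat.Rank (p_ := fun=> #|H|) j0 i :> nat.
    by rewrite tagnat.RankEsum big_pred0.
  rewrite tagnat.eq_Rank eq_sym; case: eqP => _; rewrite !mxE//.
rewrite mul_mxrow_mxcol (bigD1 j0)//= big1 => [|j /negPf->]; last by rewrite mul0mx.
rewrite mul1mx addr0; apply/colP => i; rewrite !mxE /knit_elt/=.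
by have [_ _ ->] := nuP; rewrite // invg1 mul1g.
Qed.

End CoefCol.

End Knit.

(** * Linear spans *)

Section Span.
Variables (R : realType) (V : completeNormedModType R[i]).
Variables (I : finType) (v : I -> V).

Lemma lin_span_gen i : lin_span v (v i).
Proof.
exists (fun j => (j == i)%:R); rewrite (bigD1 i)//= eqxx scale1r big1 ?addr0//.
by move=> j /negPf->; rewrite scale0r.
Qed.

Lemma lin_spanZ c x : lin_span v x -> lin_span v (c *: x).
Proof.
move=> [d ->]; exists (fun j => c * d j); rewrite scaler_sumr.
by apply: eq_bigr => j _; rewrite scalerA.
Qed.

Lemma lin_span_sum (J : finType) (F : J -> V) :
  (forall j, lin_span v (F j)) -> lin_span v (\sum_j F j).
Proof.
move=> /choice[d dE]; exists (fun i => \sum_j d j i).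
under eq_bigr do rewrite dE.
by rewrite exchange_big/=; apply: eq_bigr => i _; rewrite scaler_suml.
Qed.

End Span.

(** * The cross-covariance matrix and reconstruction *)

Section Representation.
Variables (R : realType) (V : completeNormedModType R[i]).
Variable dot : {dot V for Num.conj}.
Variables (gT : finGroupType) (U : gT -> {linear V -> V}).
Hypothesis unitU : unitary_representation dot U.

Lemma repM g h x : U (g * h)%g x = U g (U h x).
Proof. exact: unitU.2. Qed.

(** [U 1] is idempotent and injective. *)
Lemma rep1 x : U 1%g x = x.
Proof. by apply: (bij_inj (unitU.1 1%g).1); rewrite -repM mul1g. Qed.

Lemma rep_adjoint f g v : dot f (U g v) = dot (U g^-1%g f) v.
Proof. by rewrite -(unitU.1 g^-1%g).2 -repM mulVg rep1. Qed.

Variable a : V.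

Lemma rep_lin_comb (f : gT -> R[i]) y :
  U y (\sum_g f g *: U g a) = \sum_g f (y^-1 * g)%g *: U g a.
Proof.
rewrite linear_sum (reindex_inj (mulgI y^-1%g))/=.
by apply: eq_bigr => g _; rewrite linearZ -repM mulKVg.
Qed.

Lemma orbit_span_stable y x :
  lin_span (fun g => U g a) x -> lin_span (fun g => U g a) (U y x).
Proof. by move=> [f ->]; rewrite rep_lin_comb; exists (fun g => f (y^-1 * g)%g). Qed.

Variables (N H : {group gT}).
Hypothesis knitNH : knit_product N H.
Variables (nu : 'I_#|N| -> gT) (tau : 'I_#|H| -> gT).
Hypotheses (nuP : enumeration nu) (tauP : enumeration tau).
Variables (kappa : nat) (b : 'I_kappa -> V).

(** The cross-covariance matrix is the sampling map in terms of the coefficients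
    on the generators [U g a]. *)
Lemma cross_cov_mx_coef_col (f : gT -> R[i]) :
  cross_cov_mx dot nu tau U a b *m coef_col nu tau f =
  \mxcol_(k < kappa) \col_(n < #|N|) sample dot nu U (b k) (\sum_g f g *: U g a) n.
Proof.
rewrite mxcol_mul; apply: eq_mxcol => k; rewrite mul_mxrow_mxcol.
apply/colP => n; rewrite summxE mxE /sample linear_sumlz.
rewrite (reindex (knit_elt nu tau)); last exact/onW_bij/knit_elt_bij.
rewrite (eq_bigr (fun p => f (knit_elt nu tau (p.1, p.2)) *
  dot (U (knit_elt nu tau (p.1, p.2)) a) (U (nu n) (b k)))); last first.
  by move=> [j i] _; rewrite linearZl_LR.
rewrite -(pair_bigA _ (fun j i => f (knit_elt nu tau (j, i)) *
  dot (U (knit_elt nu tau (j, i)) a) (U (nu n) (b k))))/=.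
apply: eq_bigr => j _; rewrite mxE; apply: eq_bigr => i _.
by rewrite !mxE mulrC rep_adjoint -repM /cross_cov /knit_elt mulgA.
Qed.

Section Reconstruction.
Variable s : 'I_#|H| -> 'I_kappa -> 'I_#|N| -> R[i].

(** What multiplies the sample of [x] against [b k] at the identity, when the
    terms of the expansion of [x] are collected by sample. *)
Definition dual_generator (k : 'I_kappa) : V :=
  \sum_(i < #|H|) \sum_(n < #|N|) s i k n *: U ((nu n)^-1 * tau i)%g a.

Lemma dual_generator_span k : lin_span (fun g => U g a) (dual_generator k).
Proof.
apply: lin_span_sum => i; apply: lin_span_sum => n.
exact/lin_spanZ/lin_span_gen.
Qed.

(** The hypothesis recovers the coefficients at the [tau i] only. Applied to the
    translates [U y^-1 x], it recovers the coefficient at [y * tau i] as a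
    combination of the inner products of [x] with the [U (y * nu n) (b k)], which
    are samples of [x] since [y * nu n] lies in [N]. *)
Lemma dual_generator_reconstruction :
  (forall (f : gT -> R[i]) i,
     \sum_(k < kappa) \sum_(n < #|N|)
       s i k n * sample dot nu U (b k) (\sum_g f g *: U g a) n = f (tau i)) ->
  forall x, lin_span (fun g => U g a) x ->
    x = \sum_(k < kappa) \sum_(n < #|N|)
          sample dot nu U (b k) x n *: U (nu n) (dual_generator k).
Proof.
move=> s_coef x [f xE].
(* The common summand of both sides, up to reindexing of [y] over [N]. *)
pose T k i n y := (s i k n * dot x (U (y * nu n)%g (b k))) *: U (y * tau i)%g a.
have coefE y i : f (y * tau i)%g =
    \sum_(k < kappa) \sum_(n < #|N|) s i k n * dot x (U (y * nu n)%g (b k)).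
  rewrite -(s_coef (fun g => f (y * g)%g)).
  apply: eq_bigr => k _; apply: eq_bigr => n _; rewrite /sample repM [dot x _]rep_adjoint xE.
  by rewrite rep_lin_comb invgK.
transitivity (\sum_(k < kappa) \sum_(i < #|H|) \sum_(n < #|N|) \sum_(y in N) T k i n y).
  rewrite {1}xE (sum_knit knitNH nuP tauP) exchange_big/= [RHS]exchange_big/=.
  apply: eq_bigr => i _.
  under [RHS]eq_bigr do rewrite exchange_big/=.
  rewrite [RHS]exchange_big/=; apply: eq_bigr => y _.
  rewrite coefE scaler_suml; apply: eq_bigr => k _.
  by rewrite scaler_suml.
apply: eq_bigr => k _.
rewrite [RHS](reindex_enumeration (fun y => dot x (U y (b k)) *: U y (dual_generator k)) nuP).
under [RHS]eq_bigr do rewrite linear_sum scaler_sumr/=.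
rewrite [RHS]exchange_big/=; apply: eq_bigr => i _.
under [RHS]eq_bigr do rewrite linear_sum scaler_sumr/=.
rewrite [RHS]exchange_big/=; apply: eq_bigr => n _.
have nuN := enumeration_mem nuP n.
(* The sample at [z] in [N] comes from the translate by [y = z * (nu n)^-1]. *)
rewrite (reindex_inj (mulIg (nu n)^-1%g))/=.
apply: eq_big => [y|y _]; first by rewrite groupMr ?groupV.
by rewrite /T mulgKV linearZ scalerA mulrC -repM mulgA.
Qed.

End Reconstruction.

Lemma partial_left_inverse_coef (S : 'M[R[i]]_(#|H|, \sum_(k < kappa) #|N|)) :
  S *m cross_cov_mx dot nu tau U a b = pid_mx #|H| ->
  forall (f : gT -> R[i]) i,
    \sum_(k < kappa) \sum_(n < #|N|)
      submxrow S k i n * sample dot nu U (b k) (\sum_g f g *: U g a) n = f (tau i).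
Proof.
move=> SR f i; have := congr1 (mulmx^~ (coef_col nu tau f)) SR.
rewrite -mulmxA cross_cov_mx_coef_col (pid_mx_coef_col tau nuP) -[S]submxrowK mul_mxrow_mxcol.
move=> /colP/(_ i); rewrite summxE mxE => <-.
apply: eq_bigr => k _; rewrite mxE submxrowK; apply: eq_bigr => n _.
by congr (_ * _); rewrite mxE.
Qed.

(** A vector in the kernel of the matrix lists the coefficients of a vector with
    vanishing samples. *)
Lemma cross_cov_mx_full_rank :
  lin_indep (fun g => U g a) ->
  (forall x, lin_span (fun g => U g a) x ->
     (forall k n, sample dot nu U (b k) x n = 0) -> x = 0) ->
  \rank (cross_cov_mx dot nu tau U a b) = #|gT|.
Proof.
move=> indep_a sample_inj; rewrite -(cross_cov_ncols knitNH) -mxrank_tr.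
apply/eqP/inj_row_free => v vR0; apply: trmx_inj; rewrite trmx0.
have [f fE] := coef_col_surj knitNH nuP tauP v^T.
have R0 : cross_cov_mx dot nu tau U a b *m coef_col nu tau f = 0.
  by rewrite -fE -[LHS]trmxK trmx_mul trmxK vR0 trmx0.
rewrite fE; apply: coef_col0; apply: indep_a; apply: sample_inj => [|k n]; first by exists f.
move: R0; rewrite cross_cov_mx_coef_col -mxcol0 => /eq_mxcolP/(_ k)/colP/(_ n).
by rewrite !mxE.
Qed.

End Representation.

Theorem theorem3 (R : realType) (V : completeNormedModType R[i])
    (dot : {dot V for Num.conj}) (dot_norm : hilbert_norm dot)
    (gT : finGroupType) (N H : {group gT})
    (knitNH : knit_product N H) (abelN : abelian N)
    (nu : 'I_#|N| -> gT) (tau : 'I_#|H| -> gT)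
    (nuP : enumeration nu) (tauP : enumeration tau)
    (U : gT -> {linear V -> V}) (unitU : unitary_representation dot U)
    (a : V) (indep_a : lin_indep (fun g : gT => U g a))
    (kappa : nat) (b : 'I_kappa -> V) :
  let Aa : set V := lin_span (fun g : gT => U g a) in
  let L (k : 'I_kappa) (f : V) (n : 'I_#|N|) : R[i] :=
    sample dot nu U (b k) f n in
  let Rab := cross_cov_mx dot nu tau U a b in
  [<-> \rank Rab = #|gT|;
       exists S : 'M[R[i]]_(#|H|, \sum_(k < kappa) #|N|),
         (* with #|H| rows, pid_mx #|H| is the block row (I O) *)
         S *m Rab = pid_mx #|H|;
       exists c : 'I_kappa -> V,
         [/\ forall k, Aa (c k),
             frame_for dot Aa
               (fun p : 'I_kappa * 'I_#|N| => U (nu p.2) (c p.1)) &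
             forall f, Aa f ->
               f = \sum_(k < kappa) \sum_(n < #|N|)
                     L k f n *: U (nu n) (c k)];
       exists C : 'I_kappa -> 'I_#|N| -> V,
         frame_for dot Aa (fun p : 'I_kappa * 'I_#|N| => C p.1 p.2) /\
         forall f, Aa f ->
           f = \sum_(k < kappa) \sum_(n < #|N|) L k f n *: C k n].
Proof.
move=> Aa L Rab; tfae.
- move=> rkR; have /row_fullP[B BR] : row_full Rab.
    by rewrite /row_full rkR -(cross_cov_ncols knitNH).
  by exists (pid_mx #|H| *m B); rewrite -mulmxA BR mulmx1.
- move=> [S SR]; pose c := dual_generator U a nu tau (fun i k n => submxrow S k i n).
  have cA k : Aa (c k) by exact: dual_generator_span.
  have rec x : Aa x ->
      x = \sum_(k < kappa) \sum_(n < #|N|) L k x n *: U (nu n) (c k).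
    by apply: dual_generator_reconstruction => //; exact: partial_left_inverse_coef.
  exists c; split=> //.
  apply: (frame_reconstruction dot_norm (w := fun p => U (nu p.2) (b p.1))).
    by move=> p; apply: (orbit_span_stable unitU); exact: cA.
  by move=> x Ax; rewrite {1}(rec x Ax) pair_bigA.
- by move=> [c [cA frame_c rec]]; exists (fun k n => U (nu n) (c k)).
- move=> [C [_ rec]]; apply: cross_cov_mx_full_rank => // x Ax x0.
  rewrite (rec x Ax) big1// => k _; rewrite big1// => n _.
  by rewrite /L x0 scale0r.
Qed.
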